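(* Let $\mathcal{A}$ be an $n$-dimensional evolution algebra over a field $\mathbb{K}$ with natural basis $\mathcal{B}=\{e_1,\dots,e_n\}$ and structure matrix $\mathcal{M}_{\mathcal{B}}$ of rank $r$. Assume that $e_1^2,\dots,e_r^2$ are linearly independent and let $e_{r+i}^2=\sum_{k=1}^r c_{ki}e_k^2$ for all $i\in\{1,\dots,n-r\}$, with $c_{ki}\in\mathbb{K}$. A triple $(d_1,d_2,d_3)$ of linear maps on $\mathcal{A}$ is a ternary derivation of $\mathcal{A}$ if and only if the following conditions hold: (i) $d_1=\mathcal{M}_{\mathcal{B}}\,\mathrm{diag}(d_2+d_3)\,G+A$, where $A$ is a matrix such that $A\mathcal{M}_{\mathcal{B}}=0$ and $G$ is a generalised inverse of $\mathcal{M}_{\mathcal{B}}$; (ii) for all $i\in\{1,\dots,n-r\}$ and $j\in\{1,\dots,r\}$, $c_{ji}\ne0$ implies $d^{(2)}_{jj}+d^{(3)}_{jj}=d^{(2)}_{r+i,r+i}+d^{(3)}_{r+i,r+i}$; and, for all $i,j\in\{1,\dots,n\}$ with $i\neq j$: (iii) if $e_i^2=c\,e_j^2\neq 0$ for some $c\in\mathbb{K}$, $c\ne0$, then $d^{(3)}_{ij},d^{(3)}_{ji}$ are free, with $d^{(2)}_{ij}=-c^{-1}d^{(3)}_{ji}$ and $d^{(2)}_{ji}=-c\,d^{(3)}_{ij}$; (iv) if $e_i^2=0$ and $e_j^2\ne0$, then $d^{(2)}_{ij}$ and $d^{(3)}_{ij}$ are free and $d^{(2)}_{ji}=d^{(3)}_{ji}=0$;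 (v) if $e_i^2=e_j^2=0$, then $d^{(2)}_{ij},d^{(2)}_{ji},d^{(3)}_{ij},d^{(3)}_{ji}$ are free; (vi) if $e_i^2$ and $e_j^2$ are linearly independent, then $d^{(2)}_{ij}=d^{(2)}_{ji}=d^{(3)}_{ij}=d^{(3)}_{ji}=0$.
   Context: $\mathbb{K}$ is an arbitrary field. An $n$-dimensional evolution algebra is an $n$-dimensional vector space $\mathcal{A}$ over $\mathbb{K}$ with a bilinear product admitting a basis $\mathcal{B}=\{e_1,\dots,e_n\}$ (a natural basis) such that $e_ie_j=0$ for $i\neq j$. Writing $e_i^2=\sum_{k=1}^n w_{ki}e_k$, the structure matrix is $\mathcal{M}_{\mathcal{B}}=(w_{ki})$ (column $i$ is the coordinate vector of $e_i^2$). A ternary derivation of $\mathcal{A}$ is a triple $(d_1,d_2,d_3)$ of linear maps $\mathcal{A}\to\mathcal{A}$ with $d_1(xy)=d_2(x)y+xd_3(y)$ for all $x,y\in\mathcal{A}$. Write $d_\ell(e_i)=\sum_{k=1}^n d^{(\ell)}_{ki}e_k$ for $\ell=1,2,3$, and identify $d_\ell$ with its matrix $(d^{(\ell)}_{ki})$ with respect to $\mathcal{B}$. $\mathrm{diag}(d_2+d_3)$ denotes the diagonal matrix whose $k$-th diagonal entry is $d^{(2)}_{kk}+d^{(3)}_{kk}$. A generalised inverse of a square matrix $M$ is a matrix $G$ with $MGM=M$. ''Free'' means that no constraint is imposed on the entry (other than relations explicitly displayed in the same item). *)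

(* Defs.v *)
From HB Require Import structures.
From mathcomp Require Import all_boot all_order all_algebra.

Set Implicit Arguments.
Unset Strict Implicit.
Unset Printing Implicit Defensive.

Import GRing.Theory.
Local Open Scope ring_scope.

Section EvolutionAlgebra.

Variables (K : fieldType) (A : vectType K).
Variable mul : {bilinear A -> A -> A}.

(* A vector space with a bilinear product is an evolution algebra when it has
   such a basis; the product need not be associative or unital. *)
Definition natural_basis n (e : n.-tuple A) : Prop :=
  basis_of fullv e /\ (forall i j : 'I_n, i != j -> mul e`_i e`_j = 0).

Definition basis_square n (e : n.-tuple A) (i : 'I_n) : A := mul e`_i e`_i.

(* Column i holds the coordinates of e_i^2. *)
Definition structure_mx n (e : n.-tuple A) : 'M[K]_n :=
  \matrix_(k, i) coord e k (basis_square e i).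

Definition ternary_derivation (d1 d2 d3 : 'End(A)) : Prop :=
  forall x y : A, d1 (mul x y) = mul (d2 x) y + mul x (d3 y).

End EvolutionAlgebra.

(* Column i holds the coordinates of d e_i, so this acts on column vectors and
   is the transpose of the library's mxof, which acts on row vectors. *)
Definition end_mx (K : fieldType) (A : vectType K) n (e : n.-tuple A)
    (d : 'End(A)) : 'M[K]_n :=
  \matrix_(k, i) coord e k (d e`_i).

Definition diag_part (R : nzRingType) n (M : 'M[R]_n) : 'M[R]_n :=
  diag_mx (\row_k M k k).

Definition generalised_inverse (R : nzRingType) n (M G : 'M[R]_n) : Prop :=
  M *m G *m M = M.

(* A matrix entry declared free in a description of a solution set carries no
   condition. Hence True: that every value does occur is what the "if"
   direction of the characterisation using this marker asserts. *)
Definition unconstrained (T : Type) (_ : T) : Prop := True.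

(* Main.v *)
Require Import Defs.
From HB Require Import structures.
From Corelib Require Import Setoid.
From mathcomp Require Import all_boot all_order all_algebra.

Set Implicit Arguments.
Unset Strict Implicit.
Unset Printing Implicit Defensive.

Import GRing.Theory.
Local Open Scope ring_scope.

(** Both sides of the Leibniz rule are bilinear, so it is enough to test it on
    pairs of natural basis vectors. Since e_i x is the i-th coordinate of x
    times e_i^2, the rule at (e_i, e_j) is an equation between multiples of
    e_i^2 and e_j^2 only ([ternary_derivation_entriesP]).

    For i <> j the left-hand side vanishes, and the rules at (i, j) and (j, i)
    are two linear relations between the vectors e_i^2 and e_j^2. What they say
    about the four coefficients depends on whether these vectors are zero,
    proportional or independent ([pair_relationsP]); this gives (iii)-(vi).

    For i = j the rule says that e_i^2 is zero or an eigenvector of d_1 with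
    eigenvalue s_i, the i-th diagonal entry of D = diag(d_2 + d_3). All these
    equations together read d_1 M = M D ([eigen_squaresP]). This linear
    system in d_1 has
    a solution exactly when prescribing the eigenvalues s_i is compatible with
    the linear dependencies between the squares: M factors as C (I | c), with C
    injective, so that d_1 can be prescribed on the first r squares, and
    comparing coefficients in the remaining ones gives (ii)
    ([left_mul_column_scalingP]). Once the system is solvable, a generalised
    inverse of M parametrises its solutions, which is (i)
    ([left_mul_solutionP]). Solvability is essential: the matrix M D G solves
    the system only when M D has the form Y M. *)

Section Matrices.

Variable K : fieldType.

(** If N = Y M then N G M = Y M G M = N, so N G is a particular solution of
    X M = N, and the others differ from it by the left annihilator of M. *)
Lemma left_mul_solutionP n (M G N X : 'M[K]_n) :
    generalised_inverse M G -> (exists Y, Y *m M = N) ->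
  X *m M = N <-> exists B, B *m M = 0 /\ X = N *m G + B.
Proof.
move=> MGM [Y YM].
have NGM : N *m G *m M = N by rewrite -YM -!mulmxA (mulmxA M) MGM.
split=> [XM | [B [BM ->]]]; last by rewrite mulmxDl NGM BM addr0.
exists (X - N *m G); split; first by rewrite mulmxBl NGM XM subrr.
by rewrite addrC subrK.
Qed.

(** Column scaling of a rank factorisation C (I | c) by diag(d', d'') gives
    (C d' | C c d''). Comparing with (X C | X C c) forces X C = C d', and then,
    C being left cancellable, d' c = c d''; entrywise this is the condition on
    the nonzero entries of c. *)
Lemma left_mul_column_scalingP n r m (C : 'M[K]_(n, r)) (c : 'M[K]_(r, m))
    (d : 'rV[K]_(r + m)) :
    row_full C ->
  (exists X, X *m (C *m row_mx 1%:M c) = C *m row_mx 1%:M c *m diag_mx d)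
  <-> (forall i j, c j i != 0 -> d 0 (lshift m j) = d 0 (rshift r i)).
Proof.
move=> Cfull; have /row_fullP[L LC] := Cfull.
set d1 := diag_mx (lsubmx d); set d2 := diag_mx (rsubmx d).
have MdE : C *m row_mx 1%:M c *m diag_mx d = row_mx (C *m d1) (C *m (c *m d2)).
  rewrite -[d]hsubmxK diag_mx_row mul_mx_row mulmx1 mul_row_block.
  by rewrite !mulmx0 addr0 add0r -mulmxA.
have commP : c *m d2 = d1 *m c <->
    (forall i j, c j i != 0 -> d 0 (lshift m j) = d 0 (rshift r i)).
  rewrite /d1 /d2 mul_mx_diag mul_diag_mx; split=> [/matrixP cd i j cji | cd].
    have := cd j i; rewrite !mxE [RHS]mulrC => /(mulfI cji).
    by move->.
  apply/matrixP=> j i; rewrite !mxE.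
  have [-> | /cd ->] := eqVneq (c j i) 0; first by rewrite mul0r mulr0.
  by rewrite mulrC.
rewrite MdE -commP; split=> [[X] | cd].
  rewrite mul_mx_row mulmx1 mul_mx_row => /eq_row_mx[XC XCc].
  by apply: (row_full_inj Cfull); rewrite -XCc mulmxA XC mulmxA.
(* L is a left inverse of C, so this X maps each column of C to its multiple
   prescribed by d1. *)
exists (C *m d1 *m L).
rewrite mulmxA -(mulmxA _ L) LC mulmx1 mul_mx_row mulmx1 cd.
by rewrite -mulmxA.
Qed.

End Matrices.

Section Pairs.

Variables (K : fieldType) (V : vectType K).

Lemma pair_not_freeP (u v : V) : u != 0 -> v != 0 -> ~~ free [:: u; v] ->
  exists2 a : K, a != 0 & u = a *: v.
Proof.
move=> u0 v0; rewrite free_cons seq1_free v0 andbT negbK span_seq1.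
case/vlineP=> a ua; exists a => //.
by apply: contraNneq u0 => a0; rewrite ua a0 scale0r.
Qed.

Lemma free_pair_eq0 (u v : V) (p q : K) :
  free [:: u; v] -> p *: u + q *: v = 0 -> p = 0 /\ q = 0.
Proof.
rewrite free_cons seq1_free span_seq1 => /andP[uv v0] pq.
have p0 : p = 0.
  apply: contraNeq uv => p0; apply/vlineP; exists (- (p^-1 * q)).
  move/eqP: pq; rewrite addr_eq0 => /eqP pu.
  by rewrite scaleNr -scalerA -scalerN -pu scalerA mulVf ?scale1r.
split=> //; move/eqP: pq; rewrite p0 scale0r add0r scaler_eq0.
by rewrite (negPf v0) orbF => /eqP.
Qed.

(** Two vectors fall into one of the cases: one of them zero, both nonzero and
    proportional, or independent. In each case the two relations can be read
    off coefficientwise. The clauses for one zero vector are symmetric under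
    exchanging u with v, p2 with q2 and p3 with q3. When used, p2, q2, p3, q3
    are the entries (i, j), (j, i) of d_2 and of d_3. *)
Lemma pair_relationsP (u v : V) (p2 q2 p3 q3 : K) :
  (q2 *: v + p3 *: u = 0 /\ p2 *: u + q3 *: v = 0) <->
  (forall a : K, a != 0 -> u = a *: v -> a *: v != 0 ->
     [/\ unconstrained p3, unconstrained q3,
         p2 = - (a^-1 * q3) & q2 = - (a * p3)]) /\
  (u = 0 -> v != 0 ->
     [/\ unconstrained p2, unconstrained p3, q2 = 0 & q3 = 0]) /\
  (v = 0 -> u != 0 -> p2 = 0 /\ p3 = 0) /\
  (free [:: u; v] -> [/\ p2 = 0, q2 = 0, p3 = 0 & q3 = 0]).
Proof.
split=> [[uv1 uv2] | [prop [u0P [v0P freeP]]]].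
  split=> [a a0 ua av0 | ].
    move: uv1 uv2; rewrite ua !scalerA -!scalerDl => /eqP + /eqP.
    rewrite !scaler_eq0; move: av0; rewrite scaler_eq0 negb_or => /andP[_ v0].
    rewrite (negPf v0) !orbF !addr_eq0 => /eqP q2E /eqP p2E.
    split=> //; last by rewrite q2E mulrC.
    by apply: (mulIf a0); rewrite p2E mulNr mulrAC mulVf ?mul1r.
  split=> [u0 v0 | ].
    move: uv1 uv2; rewrite u0 !scaler0 add0r addr0 => /eqP + /eqP.
    by rewrite !scaler_eq0 (negPf v0) !orbF => /eqP-> /eqP->.
  split=> [v0 u0 | uv].
    move: uv1 uv2; rewrite v0 !scaler0 add0r addr0 => /eqP + /eqP.
    by rewrite !scaler_eq0 (negPf u0) !orbF => /eqP-> /eqP->.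
  rewrite addrC in uv1.
  have [-> ->] := free_pair_eq0 uv uv1.
  by have [-> ->] := free_pair_eq0 uv uv2.
have [u0 | u0] := eqVneq u 0.
  have [v0 | v0] := eqVneq v 0; first by rewrite u0 v0 !scaler0 addr0.
  by have [_ _ -> ->] := u0P u0 v0; rewrite u0 !scale0r !scaler0 addr0.
have [v0 | v0] := eqVneq v 0.
  by have [-> ->] := v0P v0 u0; rewrite v0 !scale0r !scaler0 addr0.
have [/freeP[-> -> -> ->] | ] := boolP (free [:: u; v]).
  by rewrite !scale0r addr0.
case/(pair_not_freeP u0 v0)=> a a0 ua.
have [|_ _ -> ->] := prop a a0 ua; first by rewrite -ua.
rewrite ua !scalerA -!scalerDl mulrC addNr mulNr mulrAC mulVf // mul1r addNr.
by rewrite scale0r.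
Qed.

End Pairs.

Section Algebra.

Variables (K : fieldType) (A : vectType K) (mul : {bilinear A -> A -> A}).
Variables (n : nat) (e : n.-tuple A) (he : natural_basis mul e).

Let eB : basis_of fullv e. Proof. by case: he. Qed.

Lemma coord_eq_inj u v : (forall k, coord e k u = coord e k v) -> u = v.
Proof.
move=> uv; rewrite (coord_basis eB (memvf u)) (coord_basis eB (memvf v)).
by apply: eq_bigr => k _; rewrite uv.
Qed.

Lemma natural_basis_mulr (i : 'I_n) x :
  mul e`_i x = coord e i x *: basis_square mul e i.
Proof.
rewrite [in LHS](coord_basis eB (memvf x)) linear_sum (bigD1 i) //= linearZ /=.
rewrite big1 ?addr0 // => j ji.
by rewrite linearZ /= he.2 ?scaler0 // eq_sym.
Qed.

Lemma natural_basis_mull (i : 'I_n) x :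
  mul x e`_i = coord e i x *: basis_square mul e i.
Proof.
rewrite [in LHS](coord_basis eB (memvf x)) linear_sumlz (bigD1 i) //=.
rewrite linearZl_LR /=.
rewrite big1 ?addr0 // => j ji.
by rewrite linearZl_LR /= he.2 ?scaler0.
Qed.

Lemma ternary_derivation_basisP (d1 d2 d3 : 'End(A)) :
  ternary_derivation mul d1 d2 d3 <->
  forall i j : 'I_n,
    d1 (mul e`_i e`_j) = mul (d2 e`_i) e`_j + mul e`_i (d3 e`_j).
Proof.
split=> [der i j | der x y]; first exact: der.
rewrite (coord_basis eB (memvf x)) linear_sum !linear_sumlz linear_sum.
rewrite -big_split /=; apply: eq_bigr => i _.
rewrite !linearZ !linearZl_LR linearZ -scalerDr /=; congr (_ *: _).
rewrite (coord_basis eB (memvf y)) !linear_sum -big_split /=.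
by apply: eq_bigr => j _; rewrite !linearZ /= der scalerDr.
Qed.

(** In the product (d_2 e_i) e_j only the e_j-coordinate of d_2 e_i survives,
    and in e_i (d_3 e_j) only the e_i-coordinate of d_3 e_j. *)
Lemma ternary_derivation_entriesP (d1 d2 d3 : 'End(A)) :
  let sq := basis_square mul e in
  ternary_derivation mul d1 d2 d3 <->
  (forall i, d1 (sq i) = (end_mx e d2 i i + end_mx e d3 i i) *: sq i) /\
  (forall i j, i != j ->
     end_mx e d2 j i *: sq j + end_mx e d3 i j *: sq i = 0).
Proof.
move=> sq.
have leibnizE (i j : 'I_n) : mul (d2 e`_i) e`_j + mul e`_i (d3 e`_j) =
    end_mx e d2 j i *: sq j + end_mx e d3 i j *: sq i.
  by rewrite natural_basis_mull natural_basis_mulr !mxE.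
rewrite ternary_derivation_basisP; split=> [der | [diag offdiag] i j].
  split=> [i | i j ij]; first by rewrite der leibnizE scalerDl.
  by rewrite -leibnizE -der he.2 ?linear0.
rewrite leibnizE; have [<- | ij] := eqVneq i j; first by rewrite diag scalerDl.
by rewrite he.2 // linear0 offdiag.
Qed.

Lemma end_mx_coord (d : 'End(A)) k x :
  coord e k (d x) = \sum_l end_mx e d k l * coord e l x.
Proof.
rewrite [in LHS](coord_basis eB (memvf x)) !linear_sum /=.
by apply: eq_bigr => l _; rewrite !linearZ /= mxE mulrC.
Qed.

(** Column i of M holds e_i^2: the left factor applies d to it, the right factor
    multiplies it by the i-th diagonal entry of N. *)
Lemma eigen_squaresP (d : 'End(A)) (N : 'M[K]_n) :
  let M := structure_mx mul e in
  (forall i, d (basis_square mul e i) = N i i *: basis_square mul e i) <->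
  end_mx e d *m M = M *m diag_part N.
Proof.
move=> M.
have LHSE (k i : 'I_n) :
    (end_mx e d *m M) k i = coord e k (d (basis_square mul e i)).
  by rewrite mxE end_mx_coord; apply: eq_bigr => l _; rewrite [M l i]mxE.
have RHSE (k i : 'I_n) :
    (M *m diag_part N) k i = coord e k (N i i *: basis_square mul e i).
  by rewrite /diag_part mul_mx_diag !mxE linearZ /= mulrC.
split=> [dsq | /matrixP dM i].
  by apply/matrixP=> k i; rewrite LHSE RHSE dsq.
by apply: coord_eq_inj => k; rewrite -LHSE -RHSE dM.
Qed.

End Algebra.

Lemma structure_mx_factor (K : fieldType) (A : vectType K)
    (mul : {bilinear A -> A -> A}) r m (e : (r + m).-tuple A)
    (c : 'M[K]_(r, m)) :
    (forall i : 'I_m, basis_square mul e (rshift r i) =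
       \sum_(k < r) c k i *: basis_square mul e (lshift m k)) ->
  structure_mx mul e = lsubmx (structure_mx mul e) *m row_mx 1%:M c.
Proof.
move=> hc; rewrite mul_mx_row mulmx1 -[LHS]hsubmxK; congr row_mx.
apply/matrixP=> k i; rewrite !mxE hc linear_sum /=.
by apply: eq_bigr => j _; rewrite linearZ /= !mxE mulrC.
Qed.

Theorem theorem4p8 (K : fieldType) (A : vectType K)
  (mul : {bilinear A -> A -> A}) (r m : nat) (e : (r + m).-tuple A)
  (he : natural_basis mul e)
  (hrank : \rank (structure_mx mul e) = r)
  (hfree : free [seq basis_square mul e (lshift m k) | k <- enum 'I_r])
  (c : 'M[K]_(r, m))
  (hc : forall i : 'I_m,
     basis_square mul e (rshift r i) =
     \sum_(k < r) c k i *: basis_square mul e (lshift m k))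
  (G : 'M[K]_(r + m))
  (hG : generalised_inverse (structure_mx mul e) G)
  (d1 d2 d3 : 'End(A)) :
  let M := structure_mx mul e in
  let sq := basis_square mul e in
  let D1 := end_mx e d1 in
  let D2 := end_mx e d2 in
  let D3 := end_mx e d3 in
  ternary_derivation mul d1 d2 d3 <->
  (* (i) *)
  (exists B : 'M[K]_(r + m),
     B *m M = 0 /\ D1 = M *m diag_part (D2 + D3) *m G + B) /\
  (* (ii) *)
  (forall (i : 'I_m) (j : 'I_r), c j i != 0 ->
     D2 (lshift m j) (lshift m j) + D3 (lshift m j) (lshift m j) =
     D2 (rshift r i) (rshift r i) + D3 (rshift r i) (rshift r i)) /\
  (forall i j : 'I_(r + m), i != j ->
     (* (iii) *)
     (forall a : K, a != 0 -> sq i = a *: sq j -> a *: sq j != 0 ->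
        [/\ unconstrained (D3 i j), unconstrained (D3 j i),
            D2 i j = - (a^-1 * D3 j i) & D2 j i = - (a * D3 i j)]) /\
     (* (iv) *)
     (sq i = 0 -> sq j != 0 ->
        [/\ unconstrained (D2 i j), unconstrained (D3 i j),
            D2 j i = 0 & D3 j i = 0]) /\
     (* (v) *)
     (sq i = 0 -> sq j = 0 ->
        [/\ unconstrained (D2 i j), unconstrained (D2 j i),
            unconstrained (D3 i j) & unconstrained (D3 j i)]) /\
     (* (vi) *)
     (free [:: sq i; sq j] ->
        [/\ D2 i j = 0, D2 j i = 0, D3 i j = 0 & D3 j i = 0])).
Proof.
move=> M sq D1 D2 D3.
set S := D2 + D3.
have MF : M = lsubmx M *m row_mx 1%:M c by apply: structure_mx_factor.
(* The factor C has r columns and rank at least that of M, which is r. *)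
have Cfull : row_full (lsubmx M).
  rewrite /row_full eqn_leq rank_leq_col /= -{1}hrank -/M {1}MF.
  exact: mxrankM_maxl.
have solvableP : (exists X, X *m M = M *m diag_part S) <->
    (forall (i : 'I_m) (j : 'I_r), c j i != 0 ->
     D2 (lshift m j) (lshift m j) + D3 (lshift m j) (lshift m j) =
     D2 (rshift r i) (rshift r i) + D3 (rshift r i) (rshift r i)).
  rewrite MF (left_mul_column_scalingP _ _ Cfull).
  by split=> H i j /H; rewrite !mxE.
have diagP : (forall i, d1 (sq i) = (D2 i i + D3 i i) *: sq i) <->
    D1 *m M = M *m diag_part S.
  rewrite -(eigen_squaresP he).
  by split=> H i; have := H i; rewrite [S i i]mxE.
have solutionsP : (exists X, X *m M = M *m diag_part S) ->
    D1 *m M = M *m diag_part S <->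
    exists B, B *m M = 0 /\ D1 = M *m diag_part S *m G + B.
  exact: left_mul_solutionP.
rewrite (ternary_derivation_entriesP he) diagP; split.
  case=> D1M off; have solv : exists X, X *m M = M *m diag_part S by exists D1.
  split; first exact/solutionsP.
  split; first exact/solvableP.
  move=> i j ij.
  have ji : j != i by rewrite eq_sym.
  have /pair_relationsP[p3 [p4 [_ p6]]] := conj (off i j ij) (off j i ji).
  by split; [exact: p3 | split; [exact: p4 | split; [| exact: p6]]].
case=> D1B [/solvableP solv off]; split; first exact/(solutionsP solv).
move=> i j ij; have ji : j != i by rewrite eq_sym.
have [p3 [p4 [_ p6]]] := off i j ij.
(* The clause for sq j = 0 is condition (iv) at the pair (j, i). *)
apply: (proj1 (proj2 (pair_relationsP (sq i) (sq j) (D2 i j) _ _ (D3 j i)) _)).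
split; [exact: p3 | split; [exact: p4 | split; [| exact: p6]]].
by move=> sj0 si0; have [_ [q4 _]] := off j i ji; have [_ _] := q4 sj0 si0.
Qed.
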